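(* Let $K$ be a field of characteristic zero, let $A=K+K[x]x^2$, let $a$ be a regular element of $A$ such that $a\notin K$, and let $$a=p_1\circ\cdots\circ p_r=q_1\circ\cdots\circ q_r$$ be two decompositions of maximal length of the element $a$ into irreducible polynomials of $A$. Then $\deg(p_1)=\deg(q_{\sigma(1)}),\ldots,\deg(p_r)=\deg(q_{\sigma(r)})$ for some permutation $\sigma\in S_r$.
   Context: Composition: $(a\circ b)(x):=a(b(x))$. $A=K+K[x]x^2$ is the subalgebra of $K[x]$ generated by $x^2$ and $x^3$; equivalently $A=\{a\in K[x]\mid a'(0)=0\}$. $(A,\circ)$ is a semigroup without units. A polynomial of $K[x]$ is irreducible (in $K[x]$) if it has degree $>1$ and is not a composition of two polynomials of degree $>1$. An element of $A\setminus K$ is irreducible in $A$ if it is not a composition $b\circ c$ with $b,c\in A\setminus K$. For a polynomial $a\in K[x]$ with $\deg(a)>1$, the length $l(a)$ is the number of irreducible polynomials of $K[x]$ in any decomposition of $a$ into irreducible polynomials of $K[x]$ (this number is independent of the decomposition). For $a\in A\setminus K$, the $A$-length $l_A(a)$ is the maximal $r$ such that $a=p_1\circ\cdots\circ p_r$ for some irreducible elements $p_1,\ldots,p_r$ of $A$. An element $a\in A\setminus K$ is regular if $l_A(a)=l(a)$. A decomposition $a=p_1\circ\cdots\circ p_r$ into irreducible elements of $A$ is of maximal length if $r=l_A(a)$. $S_r$ is the symmetric group. *)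

(* Defs.v *)
From mathcomp Require Import all_boot all_fingroup all_algebra.

Set Implicit Arguments.
Unset Strict Implicit.
Unset Printing Implicit Defensive.

Import GRing.Theory.
Local Open Scope ring_scope.

Definition deg (K : fieldType) (a : {poly K}) : nat := (size a).-1.

Definition in_K (K : fieldType) (a : {poly K}) : Prop :=
  exists c : K, a = c%:P.

(* A = K + K[x]x^2 *)
Definition in_A (K : fieldType) (a : {poly K}) : Prop :=
  exists (c : K) (b : {poly K}), a = c%:P + b * 'X^2.

Definition in_A_minus_K (K : fieldType) (a : {poly K}) : Prop :=
  in_A a /\ ~ in_K a.

Definition irreducible_KX (K : fieldType) (p : {poly K}) : Prop :=
  (1 < deg p)%N /\
  ~ (exists b c : {poly K}, [/\ (1 < deg b)%N, (1 < deg c)%N & p = b \Po c]).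

Definition irreducible_A (K : fieldType) (p : {poly K}) : Prop :=
  in_A_minus_K p /\
  ~ (exists b c : {poly K},
       [/\ in_A_minus_K b, in_A_minus_K c & p = b \Po c]).

(* compose [:: p_1; ...; p_r] = p_1 o ... o p_r; the empty composition is 'X,
   the neutral element of composition. *)
Definition compose (K : fieldType) (s : seq {poly K}) : {poly K} :=
  foldr (fun p b : {poly K} => p \Po b) 'X s.

Definition decomposition_KX (K : fieldType) (a : {poly K})
    (s : seq {poly K}) : Prop :=
  (forall p, p \in s -> irreducible_KX p) /\ a = compose s.

Definition decomposition_A (K : fieldType) (a : {poly K})
    (s : seq {poly K}) : Prop :=
  (forall p, p \in s -> irreducible_A p) /\ a = compose s.

(* l(a) = n.  The length is given by any one decomposition: that n does not
   depend on it is a theorem (Ritt), not part of the definition. *)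
Definition is_length (K : fieldType) (a : {poly K}) (n : nat) : Prop :=
  exists2 s : seq {poly K}, decomposition_KX a s & size s = n.

(* l_A(a) = n *)
Definition is_A_length (K : fieldType) (a : {poly K}) (n : nat) : Prop :=
  (exists2 s : seq {poly K}, decomposition_A a s & size s = n) /\
  (forall s : seq {poly K}, decomposition_A a s -> (size s <= n)%N).

(* l_A(a) = l(a), for a in A \ K *)
Definition regular (K : fieldType) (a : {poly K}) : Prop :=
  in_A_minus_K a /\ (exists2 n : nat, is_A_length a n & is_length a n).

Definition maximal_decomposition_A (K : fieldType) (a : {poly K})
    (s : seq {poly K}) : Prop :=
  decomposition_A a s /\ is_A_length a (size s).

(* Main.v *)
Require Import Defs.
From mathcomp Require Import all_boot all_fingroup all_algebra.
From mathcomp Require Import zify ring.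

Set Implicit Arguments.
Unset Strict Implicit.
Unset Printing Implicit Defensive.

Import GRing.Theory.
Local Open Scope ring_scope.

(** Counting factors turns the statement into Ritt's first theorem.  Refine the
    given factors, which are irreducible in [A], into irreducible polynomials of
    [K[x]].  By Ritt's theorem the refinement has [l(a)] factors, and regularity
    says that [l(a)] is the number of factors before refining, so no factor was
    split.  Hence both decompositions are complete decompositions in [K[x]], and
    Ritt's theorem ([ritt_first]) says that their degrees agree up to order.

    Ritt's theorem is a Jordan-Hoelder argument.  Suppose that
    [f = g1 o h1 = g2 o h2] and put [d1 = deg h1], [d2 = deg h2].

    - Least common multiples ([lcm_left_multiple_factors]).  A polynomial of
      degree [k * m] has, in characteristic zero, exactly one approximate [k]-th
      root: a monic [u] of degree [m] such that [f - c u^k] has degree less than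
      [deg f - m], where [c] is the leading coefficient of [f].  Approximate
      roots are compatible with composition on the right.  If [lcm(d1, d2) * k]
      is the degree of [f], the approximate [k]-th root of [f] can therefore be
      computed from [g1] and from [g2]; being unique, it lies both in [K[h1]]
      and in [K[h2]].

    - Greatest common right components ([gcd_right_component]).  If [f] already
      has degree [lcm(d1, d2)], then all elements of [K[h1, h2]] have degree
      divisible by [d = gcd(d1, d2)], because the products [h1^i h2^j] with
      [i < deg g1] have distinct degrees.  All large multiples of [d] occur.
      This forces [K[h1, h2]] into some [K[h]] with [deg h = d]
      ([subalgebra_generator], a polynomial form of Lueroth's theorem): counting
      dimensions gives a polynomial [P(X)] of degree [d] with coefficients in the
      algebra that vanishes at [X = x]; it divides [H(X) - H(x)] up to a factor
      from the algebra, for all [H] in it; by Gauss's lemma [P] is a multiple of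
      a polynomial that is monic in [X], and the constant coefficient of that
      polynomial is the wanted [h].

    If [h1] and [h2] are irreducible, then either the gcd is [1], and the square
    [v1 o h1 = v2 o h2] of degree [lcm(d1, d2) = d1 d2] exchanges the two degrees
    while [v1] and [v2] stay irreducible, or [h1] and [h2] differ by a linear
    polynomial on the left. *)

(** * Degrees *)

Lemma deg_comp (K : fieldType) (u v : {poly K}) :
  deg (u \Po v) = (deg u * deg v)%N.
Proof. exact: size_comp_poly. Qed.

Lemma size_deg (K : fieldType) (u : {poly K}) :
  u != 0 -> size u = (deg u).+1.
Proof. by rewrite -size_poly_gt0 /deg; case: (size u). Qed.

Lemma degM (K : fieldType) (u v : {poly K}) :
  u != 0 -> v != 0 -> deg (u * v) = (deg u + deg v)%N.
Proof.
move=> u0 v0.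
have -> : deg (u * v) = (size u + size v).-1.-1 by rewrite /deg size_mul.
by rewrite !size_deg // addSn addnS.
Qed.

Lemma deg_gt0 (K : fieldType) (u : {poly K}) : (0 < deg u)%N = (1 < size u)%N.
Proof. by rewrite /deg; case: (size u). Qed.

Lemma deg_gt0_neq0 (K : fieldType) (u : {poly K}) : (0 < deg u)%N -> u != 0.
Proof. by rewrite deg_gt0 -size_poly_gt0 => /ltnW. Qed.

Lemma comp_poly_cancelr (K : fieldType) (u v w : {poly K}) :
  (0 < deg w)%N -> u \Po w = v \Po w -> u = v.
Proof.
rewrite deg_gt0 => w1 /eqP.
by rewrite -subr_eq0 -comp_polyB comp_poly_eq0 // subr_eq0 => /eqP.
Qed.

(** Leading terms of distinct degrees cannot cancel. *)
Lemma size_sum_distinct (K : fieldType) (I : eqType) (r : seq I)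
    (F : I -> {poly K}) :
    uniq r ->
    (forall i j, i \in r -> j \in r -> F i != 0 -> F j != 0 ->
       size (F i) = size (F j) -> i = j) ->
  (forall i, i \in r -> F i = 0) \/
  (exists i, [/\ i \in r, F i != 0 & size (\sum_(j <- r) F j) = size (F i)]).
Proof.
elim: r => [|x r IH] /=; first by left.
move=> /andP[xr ur] dist.
have /IH: uniq r by [].
case=> [i j ir jr|r0|[i [ir i0 Si]]].
- by apply: dist; rewrite inE ?ir ?jr orbT.
- have S0: \sum_(j <- r) F j = 0 by rewrite big_seq big1 // => j; apply: r0.
  rewrite big_cons S0 addr0.
  have [x0|x0] := eqVneq (F x) 0; last by right; exists x; rewrite inE eqxx.
  by left=> i; rewrite inE => /predU1P[->|/r0].
rewrite big_cons; right.
have [x0|x0] := eqVneq (F x) 0.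
  by exists i; rewrite inE ir orbT x0 add0r.
have nsz: size (F x) != size (F i).
  apply/eqP=> e; have xi : x = i by apply: dist; rewrite // inE ?eqxx ?ir ?orbT.
  by rewrite xi ir in xr.
have [lt|lt] := ltnP (size (F x)) (size (F i)).
  by exists i; split=> //; rewrite ?inE ?ir ?orbT // addrC size_polyDl Si.
exists x; split=> //; rewrite ?inE ?eqxx // size_polyDl // Si.
by rewrite ltn_neqAle eq_sym nsz.
Qed.

(** The term [T`_i x^i] has degree congruent to [i] modulo [d], so the terms
    have distinct degrees.  This is how linear independence of
    [1, x, ..., x^(d-1)] over a subalgebra with degrees in [d N] is used. *)
Lemma dvdn_deg_independent (K : fieldType) (d : nat) (T : {poly {poly K}}) :
    (size T <= d)%N -> (forall i, (d %| deg T`_i)%N) -> T.['X] = 0 ->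
  T = 0.
Proof.
move=> Td dT; rewrite (horner_coef_wide _ Td) => S0.
have szF (i : 'I_d) : T`_i != 0 -> size (T`_i * 'X^i) = (deg T`_i + i).+1.
  move=> Ti; have Xi : 'X^i != 0 :> {poly K} by rewrite monic_neq0 ?monicXn.
  by rewrite size_deg ?mulf_neq0 // degM // [deg 'X^i]/deg size_polyXn.
have := @size_sum_distinct K _ (index_enum 'I_d) (fun i => T`_i * 'X^i).
rewrite S0 size_poly0; case; first exact: index_enum_uniq.
- move=> i j _ _; rewrite !mulf_eq0 !negb_or => /andP[i0 _] /andP[j0 _].
  rewrite !szF // => -[e]; apply/val_inj.
  have := congr1 (modn^~ d) e.
  have md (k : 'I_d) : (deg T`_k + k = k %[mod d])%N.
    by rewrite -modnDml (eqP (dT k)).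
  by rewrite !md !modn_small.
- move=> F0; apply/polyP=> i; rewrite coef0.
  have [id|di] := ltnP i d; last by rewrite nth_default // (leq_trans Td).
  have /eqP := F0 (Ordinal id) (mem_index_enum _).
  by rewrite /= mulf_eq0 (negPf (monic_neq0 (monicXn _ _))) orbF => /eqP.
- by case=> i [_ i0 /esym/eqP]; rewrite size_poly_eq0 (negPf i0).
Qed.

(** * Gauss's lemma over [K[x]] *)

Lemma dvdp_coefs (K : fieldType) (c : {poly K}) (P : {poly {poly K}}) :
  (forall i, c %| P`_i) -> exists P1, P = c%:P * P1.
Proof.
move=> cP; exists (map_poly (fun u => u %/ c) P).
by apply/polyP=> i; rewrite coefCM coef_map_id0 ?div0p // mulrC divpK.
Qed.

(** For a prime [c] this is Gauss's lemma.  Working with any [c] and passing to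
    a divisor [e] avoids having to factor [c] into primes: reduce [P] and [R]
    modulo [c].  The product of their leading coefficients is divisible by [c],
    although each has smaller degree than [c]; so the gcd of [c] with the leading
    coefficient of [P] is a proper non-constant divisor, which takes the place of
    [c]. *)
Lemma common_factor_coefs (K : fieldType) (c : {poly K})
    (P R : {poly {poly K}}) :
    (1 < size c)%N -> (forall i, c %| (P * R)`_i) ->
  exists e : {poly K}, [/\ (1 < size e)%N, e %| c &
    (forall i, e %| P`_i) \/ (forall i, e %| R`_i)].
Proof.
have [n] := ubnP (size c); elim: n c => // n IH c /ltnSE cn c1 cPR.
pose red (Q : {poly {poly K}}) := map_poly (fun u => u %% c) Q.
have redE Q i : (red Q)`_i = Q`_i %% c by rewrite coef_map_id0 ?mod0p.
have redP Q : exists Q1, Q = red Q + c%:P * Q1.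
  have [|Q1 eQ] := @dvdp_coefs _ c (Q - red Q).
    by move=> i; rewrite coefB redE {1}(divp_eq Q`_i c) addrK dvdp_mull.
  by exists Q1; rewrite -eQ addrC subrK.
have red0 Q : red Q = 0 -> forall i, c %| Q`_i.
  by move=> Q0 i; rewrite /dvdp -redE Q0 coef0.
have lead_red Q : red Q != 0 -> lead_coef (red Q) != 0 /\
    (size (lead_coef (red Q)) < size c)%N.
  move=> Q0; rewrite lead_coef_eq0; split=> //.
  by rewrite /lead_coef redE ltn_modp -size_poly_gt0 ltnW.
have [P0|P0] := eqVneq (red P) 0; first by exists c; split=> //; left; apply: red0.
have [R0|R0] := eqVneq (red R) 0; first by exists c; split=> //; right; apply: red0.
have [lP ltP] := lead_red _ P0; have [lR ltR] := lead_red _ R0.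
have cl : c %| lead_coef (red P) * lead_coef (red R).
  rewrite -lead_coefM /lead_coef.
  have [P1 eP] := redP P; have [R1 eR] := redP R.
  have -> : red P * red R
      = P * R - c%:P * (P1 * red R + P * R1).
    by rewrite {2 3}eP {2}eR; ring.
  by rewrite coefB coefCM dvdp_sub // dvdp_mulr.
pose g := gcdp c (lead_coef (red P)).
have [cop|ncop] := boolP (coprimep c (lead_coef (red P))).
  by move: cl; rewrite Gauss_dvdpr // => /(dvdp_leq lR); rewrite leqNgt ltR.
have g1 : (1 < size g)%N.
  have g0 : g != 0 by rewrite gcdp_eq0 (negPf lP) andbF.
  by move: ncop; rewrite /coprimep -/g; move: g0; rewrite -size_poly_gt0;
     case: (size g) => [|[]].
have gc : g %| c by exact: dvdp_gcdl.
have [|i|e [e1 eg ePR]] := IH g _ g1.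
- exact: leq_ltn_trans (dvdp_leq lP (dvdp_gcdr _ _)) (leq_trans ltP cn).
- by apply: dvdp_trans gc _.
by exists e; split=> //; apply: dvdp_trans gc.
Qed.

(** Factors of [c] are removed from [P] or from [R] until [c] is constant; then
    the leading coefficient of what remains of [P] divides that of [H], which
    is [1]. *)
Lemma gauss_monic_factor (K : fieldType) (c : {poly K})
    (P R H : {poly {poly K}}) :
    c != 0 -> H \is monic -> P * R = c%:P * H ->
  exists (e : {poly K}) (P0 : {poly {poly K}}), P = e%:P * P0 /\ P0 \is monic.
Proof.
have [n] := ubnP (size c); elim: n c P R => // n IH c P R /ltnSE cn c0 Hm PR.
have [c1|] := leqP (size c) 1.
  have lPR : lead_coef P * lead_coef R = c.
    by rewrite -lead_coefM PR lead_coefM lead_coefC (monicP Hm) mulr1.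
  have /size_poly1P[a a0 la] : size (lead_coef P) == 1.
    have /(dvdp_leq c0) : lead_coef P %| c by rewrite -lPR dvdp_mulr.
    move=> /leq_trans/(_ c1); rewrite leq_eqVlt => /orP[//|].
    rewrite ltnS leqn0 size_poly_eq0 => /eqP l0.
    by move: c0; rewrite -lPR l0 mul0r eqxx.
  exists a%:P, (a^-1%:P%:P * P); split.
    by rewrite mulrA -polyCM -polyCM divff // mul1r.
  by rewrite monicE lead_coefM lead_coefC la -polyCM mulVf.
move=> c1; have [i|e [e1 ec ePR]] := common_factor_coefs (P:=P) (R:=R) c1.
  by rewrite PR coefCM dvdp_mulr.
have e0 : e != 0 by rewrite -size_poly_gt0 ltnW.
have eP0 : e%:P != 0 :> {poly {poly K}} by rewrite polyC_eq0.
have ceq : c = e * (c %/ e) by rewrite mulrC divpK.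
have ce0 : c %/ e != 0 by apply: contraNneq c0 => z; rewrite ceq z mulr0.
have ltce : (size (c %/ e)%R < n)%N.
  apply: leq_trans cn; rewrite size_divp // ltn_subrL -subn1 subn_gt0 e1.
  exact: ltnW.
case: ePR => /dvdp_coefs[Q eQ].
  have [|f [P0 [Qf P0m]]] := IH _ Q R ltce ce0 Hm.
    apply: (mulfI eP0); rewrite [RHS]mulrA -polyCM -ceq -PR eQ; ring.
  by exists (e * f), P0; rewrite eQ Qf polyCM mulrA.
apply: (IH _ P Q ltce ce0 Hm).
by apply: (mulfI eP0); rewrite [RHS]mulrA -polyCM -ceq -PR eQ; ring.
Qed.

(** * Subalgebras of [K[x]] with prescribed degrees *)

Lemma size_sub_lead (R : nzRingType) (u v : {poly R}) :
    u != 0 -> size u = size v -> lead_coef u = lead_coef v ->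
  (size (u - v)%R < size u)%N.
Proof.
rewrite -size_poly_gt0 => u0 uv luv; rewrite -[ltnRHS](prednK u0) ltnS.
apply/leq_sizeP => j; rewrite leq_eqVlt coefB => /predU1P[<-|].
  by move: luv; rewrite /lead_coef -uv => ->; rewrite subrr.
rewrite prednK // => uj.
by rewrite [u`_j]nth_default // [v`_j]nth_default ?subrr // -uv.
Qed.

Lemma deg_exp (K : fieldType) (u : {poly K}) n : deg (u ^+ n) = (deg u * n)%N.
Proof. exact: size_exp. Qed.

Lemma deg_scale (K : fieldType) (c : K) (u : {poly K}) :
  c != 0 -> deg (c *: u) = deg u.
Proof. by move=> c0; rewrite /deg size_scale. Qed.

(** The step of the inductions on degree below: a subalgebra that contains [v]
    allows the leading term of [u] to be removed. *)
Lemma deg_descent (K : fieldType) (u v : {poly K}) :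
    u != 0 -> v != 0 -> deg u = deg v ->
  exists2 c : K, c != 0 & (size (u - c *: v)%R < size u)%N.
Proof.
move=> u0 v0 uv; exists (lead_coef u / lead_coef v).
  by rewrite mulf_neq0 ?invr_eq0 ?lead_coef_eq0.
apply: size_sub_lead => //.
  by rewrite size_scale ?mulf_neq0 ?invr_eq0 ?lead_coef_eq0 // !size_deg ?uv.
by rewrite lead_coefZ divfK // lead_coef_eq0.
Qed.

Lemma linear_dependency (K : fieldType) n (r : 'I_n.+1 -> {poly K}) :
    (forall j, (size (r j) <= n)%N) ->
  exists2 w : 'rV[K]_n.+1, w != 0 & \sum_j w 0 j *: r j = 0.
Proof.
move=> rn; pose M : 'M[K]_(n.+1, n) := \matrix_(j, i) (r j)`_i.
have /rowV0Pn[w wM w0] : kermx M != 0.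
  rewrite kermx_eq0 /row_free; apply/eqP=> e.
  by have := rank_leq_col M; rewrite e ltnn.
exists w => //; apply/polyP=> i; rewrite coef_sum coef0.
have [ni|ni] := ltnP i n; last first.
  by apply: big1 => j _; rewrite coefZ nth_default ?mulr0 // (leq_trans (rn j)).
have /sub_kermxP/matrixP/(_ 0 (Ordinal ni)) := wM.
rewrite !mxE => e; rewrite -[RHS]e; apply: eq_bigr => j _.
by rewrite coefZ mxE.
Qed.

Record subalgebra (K : fieldType) (B : {poly K} -> Prop) : Prop := {
  subalgC : forall c, B c%:P;
  subalgD : forall u v, B u -> B v -> B (u + v);
  subalgM : forall u v, B u -> B v -> B (u * v) }.

Definition coefs_in (K : fieldType) (B : {poly K} -> Prop)
  (T : {poly {poly K}}) : Prop := forall i, B T`_i.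

Section SubalgebraClosure.
Variables (K : fieldType) (B : {poly K} -> Prop) (algB : subalgebra B).

Lemma subalgZ c u : B u -> B (c *: u).
Proof. by move=> Bu; rewrite -mul_polyC; apply: subalgM => //; apply: subalgC. Qed.

Lemma subalg0 : B 0. Proof. exact: (subalgC algB 0). Qed.

Lemma subalgB u v : B u -> B v -> B (u - v).
Proof. by move=> Bu Bv; rewrite -scaleN1r; apply: subalgD => //; apply: subalgZ. Qed.

Lemma subalgX u n : B u -> B (u ^+ n).
Proof.
move=> Bu; elim: n => [|n IH]; first exact: (subalgC algB 1).
by rewrite exprS; apply: subalgM.
Qed.

Lemma subalg_sum (I : Type) (r : seq I) (F : I -> {poly K}) :
  (forall i, B (F i)) -> B (\sum_(i <- r) F i).
Proof.
move=> BF; elim/big_rec: _ => [|i u _ Bu]; first exact: subalg0.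
exact: subalgD.
Qed.

Lemma coefs_inC u : B u -> coefs_in B u%:P.
Proof. by move=> Bu i; rewrite coefC; case: eqP => // _; apply: subalg0. Qed.

Lemma coefs_inXn n : coefs_in B 'X^n.
Proof.
move=> i; rewrite coefXn; case: eqP => _; last exact: subalg0.
exact: (subalgC algB 1).
Qed.

Lemma coefs_inD T U : coefs_in B T -> coefs_in B U -> coefs_in B (T + U).
Proof. by move=> BT BU i; rewrite coefD; apply: subalgD. Qed.

Lemma coefs_inB T U : coefs_in B T -> coefs_in B U -> coefs_in B (T - U).
Proof. by move=> BT BU i; rewrite coefB; apply: subalgB. Qed.

Lemma coefs_inM T U : coefs_in B T -> coefs_in B U -> coefs_in B (T * U).
Proof.
by move=> BT BU i; rewrite coefM; apply: subalg_sum => j; apply: subalgM.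
Qed.

(** Every operation of the division algorithm, including the multiplication by
    powers of the leading coefficient, stays in the subalgebra; this keeps the
    remainder within reach of [dvdn_deg_independent]. *)
Lemma coefs_in_pseudo_division (P G : {poly {poly K}}) :
    coefs_in B P -> P != 0 -> coefs_in B G ->
  exists (c : {poly K}) (Q R : {poly {poly K}}),
    [/\ c != 0, c%:P * G = Q * P + R, coefs_in B R & (size R < size P)%N].
Proof.
move=> BP P0; have [n] := ubnP (size G); elim: n G => // n IH G /ltnSE Gn BG.
have [lt|le] := ltnP (size G) (size P).
  by exists 1, 0, G; rewrite oner_eq0 mul0r add0r polyC1 mul1r.
have G0 : G != 0 by rewrite -size_poly_gt0 (leq_trans _ le) ?size_poly_gt0.
have l0 : lead_coef P != 0 by rewrite lead_coef_eq0.
pose S : {poly {poly K}} := (lead_coef G)%:P * 'X^(size G - size P).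
have S0 : S != 0.
  by rewrite mulf_neq0 ?polyC_eq0 ?lead_coef_eq0 // monic_neq0 ?monicXn.
have szS : size S = (size G - size P).+1.
  by rewrite /S mul_polyC size_scale ?lead_coef_eq0 // size_polyXn.
have lt : (size ((lead_coef P)%:P * G - S * P)%R < size G)%N.
  have szG : size ((lead_coef P)%:P * G) = size G.
    by rewrite mul_polyC size_scale.
  rewrite -[X in (_ < X)%N]szG; apply: size_sub_lead.
  - by rewrite mulf_neq0 ?polyC_eq0.
  - by rewrite szG size_mul // szS addSn /= subnK.
  - by rewrite !lead_coefM !lead_coefC lead_coefXn mulr1 mulrC.
have [|c [Q [R [c0 eQR BR szR]]]] := IH _ (leq_trans lt Gn).
  apply: coefs_inB; apply: coefs_inM => //; first by apply: coefs_inC; apply: BP.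
  by apply: coefs_inM; [apply: coefs_inC; apply: BG | apply: coefs_inXn].
exists (c * lead_coef P), (Q + c%:P * S), R; split=> //; first by rewrite mulf_neq0.
have -> : (Q + c%:P * S) * P + R = (Q * P + R) + c%:P * (S * P) by ring.
by rewrite -eQR polyCM; ring.
Qed.

End SubalgebraClosure.

(** [x^i] times an element of [B] reaches every large degree congruent to [i]
    modulo [d]; so [B + B x + ... + B x^(d-1)] has finite codimension in
    [K[x]]. *)
Lemma subalgebra_reduction (K : fieldType) (B : {poly K} -> Prop) (d k0 : nat) :
    subalgebra B -> (0 < d)%N ->
    (forall k, (k0 <= k)%N -> exists b, [/\ B b, b != 0 & deg b = (k * d)%N]) ->
  forall g, exists T : {poly {poly K}},
    [/\ coefs_in B T, (size T <= d)%N & (size (g - T.['X])%R <= k0 * d)%N].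
Proof.
move=> algB d0 big g; have [n] := ubnP (size g); elim: n g => // n IH g /ltnSE gn.
have [le|lt] := leqP (size g) (k0 * d).
  exists 0; rewrite horner0 subr0 size_poly0; split=> // i.
  by rewrite coef0; apply: subalg0.
have g0 : g != 0 by rewrite -size_poly_gt0 (leq_ltn_trans _ lt).
have [|b [Bb b0 db]] := big (deg g %/ d)%N.
  by rewrite leq_divRL // -ltnS -size_deg.
have Xi : 'X^(deg g %% d) != 0 :> {poly K} by rewrite monic_neq0 ?monicXn.
have [||c c0 ltc] := @deg_descent _ g (b * 'X^(deg g %% d)) g0.
- by rewrite mulf_neq0.
- by rewrite degM // db [deg 'X^_]/deg size_polyXn -divn_eq.
have [T [BT szT gT]] := IH _ (leq_trans ltc gn).
exists (T + (c *: b)%:P * 'X^(deg g %% d)); split.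
- apply: coefs_inD => //; apply: coefs_inM => //; last exact: coefs_inXn.
  by apply: coefs_inC => //; apply: subalgZ.
- rewrite (leq_trans (size_polyD _ _)) // geq_max szT mul_polyC.
  by rewrite (leq_trans (size_scale_leq _ _)) // size_polyXn ltn_mod.
- move: gT; rewrite hornerD hornerM hornerC hornerXn scalerAl.
  by rewrite -addrA -opprD (addrC (_ * _)).
Qed.

(** The field of fractions of [B] has index at most [d] in [K(x)].  For a
    non-constant [H] in [B], all [H^j x^d] reduce to a space of finite dimension,
    so some combination of them, with coefficients in [K], lies in
    [B + B x + ... + B x^(d-1)].  The coefficient of [x^d] in this relation is a
    non-zero polynomial in [H]. *)
Lemma subalgebra_relation (K : fieldType) (B : {poly K} -> Prop) (d k0 : nat) :
    subalgebra B -> (0 < d)%N ->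
    (forall k, (k0 <= k)%N -> exists b, [/\ B b, b != 0 & deg b = (k * d)%N]) ->
  exists P : {poly {poly K}}, [/\ coefs_in B P, size P = d.+1 & P.['X] = 0].
Proof.
move=> algB d0 big; have red := subalgebra_reduction algB d0 big.
have [H [BH H0 dH]] := big k0.+1 (leqnSn _).
have [T redT] := fin_all_exists (fun j : 'I_(k0 * d).+1 => red (H ^+ j * 'X^d)).
have [|w w0 depw] := @linear_dependency K (k0 * d)
    (fun j => H ^+ j * 'X^d - (T j).['X]).
  by move=> j; case: (redT j).
pose b : {poly K} := \sum_j w 0 j *: H ^+ j.
have b0 : b != 0.
  have := @size_sum_distinct K _ (index_enum _) (fun j => w 0 j *: H ^+ j)
    (index_enum_uniq _).
  case=> [i j _ _||[i [_ Fi sz]]].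
  - rewrite !scaler_eq0 !negb_or => /andP[wi _] /andP[wj _].
    rewrite !size_scale // !size_deg ?expf_neq0 // !deg_exp dH => -[/eqP e].
    apply/val_inj/eqP; move: e; rewrite eqn_pmul2l // muln_gt0 //.
  - move=> F0; case/negP: w0; apply/eqP/rowP=> j; rewrite mxE.
    have /eqP := F0 j (mem_index_enum _).
    by rewrite scaler_eq0 expf_eq0 (negPf H0) andbF orbF => /eqP.
  - by rewrite -size_poly_gt0 sz size_poly_gt0.
pose U : {poly {poly K}} := \sum_j (w 0 j)%:P%:P * T j.
have szU : (size U <= d)%N.
  apply: (leq_trans (size_sum _ _ _)); apply/bigmax_leqP => j _.
  rewrite mul_polyC (leq_trans (size_scale_leq _ _)) //.
  by case: (redT j).
exists (b%:P * 'X^d - U); split.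
- apply: coefs_inB => //.
    apply: coefs_inM (coefs_inXn _ _) => //; apply: coefs_inC => //.
    by apply: subalg_sum => // j; apply: subalgZ => //; apply: subalgX.
  move=> i; rewrite coef_sum; apply: subalg_sum => // j; rewrite coefCM.
  by apply: subalgM => //; [apply: subalgC | case: (redT j)].
- have szb : size (b%:P * 'X^d) = d.+1.
    by rewrite mul_polyC size_scale // size_polyXn.
  by rewrite size_polyDl szb // size_polyN ltnS.
- rewrite hornerD hornerN hornerM hornerC hornerXn horner_sum.
  rewrite mulr_suml -sumrB -[RHS]depw; apply: eq_bigr => j _.
  by rewrite hornerM hornerC mul_polyC scalerBr scalerAl.
Qed.

(** A polynomial form of Lueroth's theorem.  The relation [P(x) = 0] given by
    [subalgebra_relation] is the minimal polynomial of [x] over the fractions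
    of [B].  Gauss's lemma makes the quotient [h] of its extreme coefficients a
    polynomial, and comparing degrees gives [deg h = d].  Elements of [B], and
    more generally fractions of [B] that are polynomials, then descend to
    constants by subtracting multiples of powers of [h]. *)
Lemma subalgebra_generator (K : fieldType) (B : {poly K} -> Prop)
    (d k0 : nat) :
    subalgebra B -> (0 < d)%N -> (forall b, B b -> (d %| deg b)%N) ->
    (forall k, (k0 <= k)%N -> exists b, [/\ B b, b != 0 & deg b = (k * d)%N]) ->
  exists2 h, deg h = d & forall b, B b -> exists u, b = u \Po h.
Proof.
move=> algB d0 dB big.
have [P [BP szP PX]] := subalgebra_relation algB d0 big.
have P0 : P != 0 by rewrite -size_poly_gt0 szP.
have lP : lead_coef P = P`_d by rewrite /lead_coef szP.
have Pd0 : P`_d != 0 by rewrite -lP lead_coef_eq0.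
have [H1 [BH1 H10 dH1]] := big k0.+1 (leqnSn _).
pose H := (lead_coef H1)^-1 *: H1.
have lH1 : lead_coef H1 != 0 by rewrite lead_coef_eq0.
have Hm : H \is monic by rewrite monicE lead_coefZ mulVf.
have szH : (1 < size H)%N.
  by rewrite size_scale ?invr_eq0 // -deg_gt0 dH1 muln_gt0.
(* [H(X) - H(x)], as a polynomial in [X] with coefficients in [K[x]]. *)
pose G : {poly {poly K}} := H^:P - H%:P.
have ltHG : (size (- H%:P) < size H^:P)%N.
  by rewrite size_polyN size_map_polyC (leq_ltn_trans (size_polyC_leq1 _)).
have Gm : G \is monic.
  by rewrite monicE lead_coefDl // lead_coef_map_inj ?(monicP Hm) //; apply: polyC_inj.
have BG : coefs_in B G.
  apply: coefs_inB => //; last by apply: coefs_inC => //; apply: subalgZ.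
  by move=> i; rewrite coef_map; apply: subalgC.
have GX : G.['X] = 0.
  by rewrite hornerD hornerN hornerC -[H^:P.['X]]/(H \Po 'X) comp_polyXr subrr.
have [c [Q [R [c0 eG BR szR]]]] := coefs_in_pseudo_division algB BP P0 BG.
have R0 : R = 0.
  apply: (@dvdn_deg_independent _ d); first by rewrite -ltnS -szP.
    by move=> i; apply: dB.
  have := congr1 (fun W => W.['X]) eG.
  by rewrite hornerD !hornerM GX PX !mulr0 add0r.
have [e [P1 [eP P1m]]] : exists (e : {poly K}) P1, P = e%:P * P1 /\ P1 \is monic.
  apply: (@gauss_monic_factor _ c P Q G c0 Gm).
  by rewrite eG R0 addr0 mulrC.
have ed : e = P`_d by rewrite -lP eP lead_coefM lead_coefC (monicP P1m) mulr1.
have e0 : e != 0 by rewrite ed.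
pose h := P1`_0.
have eh : e * h = P`_0 by rewrite eP coefCM.
(* Otherwise the leading terms of [P`_0] and [P`_d x^d] do not cancel, and the sum
   of these two could serve as constant coefficient of a relation of degree less
   than [d]. *)
have szP0 : size P`_0 = size (P`_d * 'X^d).
  apply/eqP/negPn/negP=> ne.
  have Xd0 : 'X^d != 0 :> {poly K} by rewrite monic_neq0 ?monicXn.
  have dPdX : (d %| deg (P`_d * 'X^d))%N.
    by rewrite degM // [deg 'X^_]/deg size_polyXn dvdn_addl ?dB.
  pose T : {poly {poly K}} :=
    \poly_(i < d) (if i == 0%N then P`_0 + P`_d * 'X^d else P`_i).
  have T0 : T = 0.
    apply: (@dvdn_deg_independent _ d); first exact: size_poly.
    - move=> i; rewrite coef_poly; case: ltnP => _; last first.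
        by rewrite /deg size_poly0.
      case: eqP => _; last exact: dB.
      have [lt|] := ltnP (size P`_0) (size (P`_d * 'X^d)).
        by rewrite /deg addrC size_polyDl.
      rewrite leq_eqVlt eq_sym (negPf ne) /= => lt.
      by rewrite /deg size_polyDl //; apply: dB.
    - rewrite -[RHS]PX (@horner_coef_wide _ d.+1 P) ?szP // big_ord_recr /=.
      rewrite /T horner_poly; case: {+}d d0 => // d' _.
      rewrite !big_ord_recl /= !expr0 !mulr1 -!addrA; congr (_ + _).
      by rewrite addrC; congr (_ + _); apply: eq_bigr.
  have := congr1 (fun W : {poly {poly K}} => W`_0) T0.
  rewrite coef_poly d0 eqxx coef0 => /eqP; rewrite addr_eq0 => /eqP eP0.
  by case/negP: ne; rewrite eP0 size_polyN.
have P00 : P`_0 != 0.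
  by rewrite -size_poly_gt0 szP0 size_poly_gt0 mulf_neq0 // monic_neq0 ?monicXn.
have h0 : h != 0 by apply: contraNneq P00 => z; rewrite -eh z mulr0.
have dh : deg h = d.
  have : deg (e * h) = deg (P`_d * 'X^d) by rewrite eh /deg szP0.
  have Xd0 : 'X^d != 0 :> {poly K} by rewrite monic_neq0 ?monicXn.
  rewrite (degM e0 h0) (degM Pd0 Xd0) ed => /addnI ->.
  by rewrite /deg size_polyXn.
exists h => // b Bb.
(* The induction leaves [B], but not its fractions: [a] is a denominator. *)
have {Bb} : exists a, [/\ B a, a != 0 & B (a * b)].
  by exists 1; rewrite mul1r oner_eq0; split=> //; apply: (subalgC algB 1).
have [n] := ubnP (size b); elim: n b => // n IH b /ltnSE bn [a [Ba a0 Bab]].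
have [b1|b1] := posnP (deg b).
  exists b; move: b1; rewrite /deg.
  by case: (size b) (size1_polyC (p := b)) => [|[|]] // -> // _; rewrite comp_polyC.
have b0 := deg_gt0_neq0 b1.
have /dvdnP[k kb] : (d %| deg b)%N.
  by have := dB _ Bab; rewrite degM // dvdn_addr // dB.
have [|c' c'0 lt] := @deg_descent _ b (h ^+ k) b0 (expf_neq0 _ h0).
  by rewrite deg_exp dh kb mulnC.
have [|u eu] := IH _ (leq_trans lt bn).
  exists (a * e ^+ k); rewrite mulf_neq0 ?expf_neq0 //; split=> //.
    by apply: subalgM => //; apply: subalgX => //; rewrite ed.
  have -> : a * e ^+ k * (b - c' *: h ^+ k)
      = e ^+ k * (a * b) - c' *: (a * (e * h) ^+ k).
    by rewrite -!mul_polyC exprMn; ring.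
  apply: subalgB => //; first by apply: subalgM => //; apply: subalgX => //; rewrite ed.
  by apply: subalgZ => //; apply: subalgM => //; apply: subalgX => //; rewrite eh.
exists (u + c' *: 'X^k).
by rewrite comp_polyD comp_polyZ comp_Xn_poly -eu subrK.
Qed.

(** * Greatest common right components *)

(** From Bezout's [gcd = u d1 - v d2]: writing [k = q m + r] with
    [m = d2 / gcd], the combination for [r] has a bounded negative part, which
    [q d2] absorbs when [k] is large. *)
Lemma large_multiples_of_gcd (d1 d2 : nat) : (0 < d1)%N ->
  exists k0, forall k, (k0 <= k)%N ->
    exists i j, (i * d1 + j * d2 = k * gcdn d1 d2)%N.
Proof.
move=> d1p; case: (egcdnP d2 d1p) => u v e _.
pose m := (d2 %/ gcdn d1 d2)%N.
have md : (m * gcdn d1 d2 = d2)%N by rewrite divnK ?dvdn_gcdr.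
have [m0|mp] := posnP m.
  exists 0%N => k _; exists (k * u)%N, 0%N.
  by rewrite mul0n addn0 -mulnA e -md m0 !mul0n !muln0 add0n.
exists (m * v * m)%N => k; rewrite -leq_divRL // => lek.
exists (k %% m * u)%N, (k %/ m - k %% m * v)%N.
have le : (k %% m * v <= k %/ m)%N.
  apply: leq_trans lek; rewrite leq_mul2r; apply/orP; right.
  by rewrite ltnW // ltn_mod.
set r := (k %% m)%N; set q := (k %/ m)%N.
have ek : (k * gcdn d1 d2 = q * d2 + r * gcdn d1 d2)%N.
  by rewrite {1}(divn_eq k m) mulnDl -mulnA md.
rewrite ek -mulnA e mulnDr mulnBl -mulnA.
have := leq_mul le (leqnn d2); rewrite -/r -/q -mulnA => le2.
by rewrite addnAC subnKC.
Qed.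

Lemma deg_eq_mod_lcm (d1 d2 s i j x y : nat) :
    (s * d1 = lcmn d1 d2)%N -> (0 < d1)%N -> (i < s)%N -> (j < s)%N ->
    (x * d2 + i * d1 = y * d2 + j * d1)%N -> i = j.
Proof.
move=> sd d1p; wlog ij : i j x y / (i <= j)%N => [W is_ js e|is_ js e].
  case/orP: (leq_total i j) => le; first exact: W le is_ js e.
  by apply/esym; apply: W le js is_ (esym e).
apply/eqP; rewrite eqn_leq ij /=.
have : (s * d1 %| (j - i) * d1)%N.
  rewrite sd dvdn_lcm dvdn_mull //=; apply/dvdnP; exists (x - y)%N.
  by rewrite !mulnBl; lia.
rewrite dvdn_pmul2r // => /dvdnP[[|q]]; first by lia.
by rewrite mulSn; lia.
Qed.

(** The subalgebra [K[h1, h2]], its elements written as polynomials in [h1] whose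
    coefficients are polynomials in [h2]. *)
Definition generated (K : fieldType) (h1 h2 b : {poly K}) : Prop :=
  exists T : {poly {poly K}}, b = (map_poly (comp_poly h2) T).[h1].

Lemma generated_subalgebra (K : fieldType) (h1 h2 : {poly K}) :
  subalgebra (generated h1 h2).
Proof.
split=> [c|u v [T ->] [U ->]|u v [T ->] [U ->]].
- by exists c%:P%:P; rewrite map_polyC /= comp_polyC hornerC.
- by exists (T + U); rewrite rmorphD hornerD.
- by exists (T * U); rewrite rmorphM hornerM.
Qed.

Lemma generated_fst (K : fieldType) (h1 h2 : {poly K}) : generated h1 h2 h1.
Proof. by exists 'X; rewrite map_polyX hornerX. Qed.

Lemma generated_snd (K : fieldType) (h1 h2 : {poly K}) : generated h1 h2 h2.
Proof. by exists 'X%:P; rewrite map_polyC /= comp_polyX hornerC. Qed.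

(** The equation [g1(h1) = g2(h2)] makes [h1] integral of degree [deg g1] over
    [K[h2]], so [b] is a sum of terms [r_i(h2) h1^i] with [i < deg g1].  Their
    degrees are distinct modulo [deg h2], because [deg g1 * deg h1] is the least
    common multiple; so the degree of [b] is that of one of the terms. *)
Lemma generated_deg (K : fieldType) (g1 g2 h1 h2 b : {poly K}) :
    g1 \Po h1 = g2 \Po h2 -> (0 < deg g1)%N -> (0 < deg h1)%N ->
    (deg g1 * deg h1 = lcmn (deg h1) (deg h2))%N ->
  generated h1 h2 b -> (gcdn (deg h1) (deg h2) %| deg b)%N.
Proof.
move=> eg g1p h1p lcm [T ->].
have g10 := deg_gt0_neq0 g1p; have h10 := deg_gt0_neq0 h1p.
have lg1 : lead_coef g1 != 0 by rewrite lead_coef_eq0.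
pose g := (lead_coef g1)^-1 *: g1.
(* The monic equation of [h1] over [K[h2]]; [x] stands for [h2] in its
   coefficients. *)
pose G : {poly {poly K}} := g^:P - ((lead_coef g1)^-1 *: g2)%:P.
have gm : g \is monic by rewrite monicE lead_coefZ mulVf.
have szg : size g = (deg g1).+1 by rewrite size_scale ?invr_eq0 // size_deg.
have lt (u : {poly K}) : (size (- u%:P)%R < size g^:P)%N.
  by rewrite size_polyN size_map_polyC szg (leq_ltn_trans (size_polyC_leq1 _)).
have Gm : G \is monic.
  by rewrite monicE lead_coefDl // lead_coef_map_inj ?(monicP gm) //; apply: polyC_inj.
have szG : size G = (deg g1).+1 by rewrite size_polyDl // size_map_polyC.
have G0 : (map_poly (comp_poly h2) G).[h1] = 0.
  rewrite rmorphB /= map_polyC /= hornerD hornerN hornerC -map_poly_comp.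
  rewrite (eq_map_poly (g := polyC)); last by move=> c; rewrite /= comp_polyC.
  by rewrite -[g^:P.[h1]]/(g \Po h1) !comp_polyZ eg subrr.
have -> : (map_poly (comp_poly h2) T).[h1]
    = (map_poly (comp_poly h2) (Pdiv.Ring.rmodp T G)).[h1].
  rewrite {1}(Pdiv.RingMonic.rdivp_eq Gm T) rmorphD rmorphM /= hornerD hornerM.
  by rewrite G0 mulr0 add0r.
set R := Pdiv.Ring.rmodp T G.
have szR : (size R <= deg g1)%N.
  by rewrite -ltnS -szG Pdiv.Ring.ltn_rmodp monic_neq0.
rewrite (@horner_coef_wide _ (deg g1)); last first.
  exact: leq_trans (size_poly _ _) szR.
under eq_bigr => i _ do rewrite coef_map /=.
pose F (i : 'I_(deg g1)) := (R`_i \Po h2) * h1 ^+ i.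
have degF i : F i != 0 -> deg (F i) = (deg R`_i * deg h2 + i * deg h1)%N.
  rewrite mulf_eq0 negb_or => /andP[u0 v0].
  by rewrite degM // deg_comp deg_exp (mulnC i).
have := @size_sum_distinct K _ (index_enum _) F (index_enum_uniq _).
case=> [i j _ _ i0 j0||[i [_ i0 sz]]].
- rewrite !size_deg // !degF // => -[e].
  by apply/val_inj; apply: deg_eq_mod_lcm lcm h1p _ _ e.
- by move=> F0; rewrite big1 ?/deg ?size_poly0 // => i _; apply: F0; apply: mem_index_enum.
have -> : deg (\sum_i F i) = deg (F i) by rewrite /deg sz.
by rewrite degF // dvdn_add // dvdn_mull // ?dvdn_gcdl ?dvdn_gcdr.
Qed.

(** The degrees in [K[h1, h2]] are multiples of the gcd by [generated_deg], and
    the products [h1^i h2^j] already provide all large multiples, so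
    [subalgebra_generator] applies. *)
Lemma gcd_right_component (K : fieldType) (g1 g2 h1 h2 : {poly K}) :
    g1 \Po h1 = g2 \Po h2 -> (0 < deg g1)%N -> (0 < deg h1)%N ->
    (deg g1 * deg h1 = lcmn (deg h1) (deg h2))%N ->
  exists h u1 u2, [/\ deg h = gcdn (deg h1) (deg h2), h1 = u1 \Po h & h2 = u2 \Po h].
Proof.
move=> eg g1p h1p lcm.
have [k0 big] := large_multiples_of_gcd (deg h2) h1p.
have algB := generated_subalgebra h1 h2.
have h20 : h2 != 0.
  apply: deg_gt0_neq0; have := congr1 (@deg K) eg.
  rewrite !deg_comp lt0n => e; apply/eqP=> z; move/eqP: e.
  by rewrite z muln0 muln_eq0 !eqn0Ngt g1p h1p.
have [||k|h dh Bh] := @subalgebra_generator K _ (gcdn (deg h1) (deg h2)) k0 algB.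
- by rewrite gcdn_gt0 h1p.
- by move=> b; apply: generated_deg eg _ _ _.
- move=> /big[i [j e]]; exists (h1 ^+ i * h2 ^+ j).
  have h10 := deg_gt0_neq0 h1p.
  rewrite mulf_neq0 ?expf_neq0 // degM ?expf_neq0 // !deg_exp -e.
  split=> //; last by rewrite mulnC (mulnC j).
  apply: subalgM => //; apply: subalgX => //; [exact: generated_fst | exact: generated_snd].
have [u1 e1] := Bh _ (generated_fst h1 h2).
have [u2 e2] := Bh _ (generated_snd h1 h2).
by exists h, u1, u2.
Qed.

(** * Approximate roots and least common left multiples *)

(** The bound says that the degree of [f - c u^k] is less than
    [deg f - deg u], when [deg f = k deg u]. *)
Definition approximate_root (K : fieldType) (k : nat) (f u : {poly K}) : Prop :=
  u \is monic /\
  (size (f - lead_coef f *: u ^+ k)%R <= deg u * k.-1)%N.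

(** The cofactor of [u - v] in [u^k - v^k] has as leading coefficient the integer
    [k], which must not vanish in [K]: this is where the characteristic
    matters. *)
Lemma sum_powers_lead (K : fieldType) (charK0 : [pchar K] =i pred0)
    (u v : {poly K}) (k : nat) :
    (0 < k)%N -> u \is monic -> v \is monic -> deg u = deg v ->
  size (\sum_(i < k) u ^+ (k.-1 - i) * v ^+ i) = (deg u * k.-1).+1 /\
  lead_coef (\sum_(i < k) u ^+ (k.-1 - i) * v ^+ i) = k%:R.
Proof.
move=> k0 um vm duv; set S := \sum_(i < k) _.
have k0R : k%:R != 0 :> K by move/pcharf0P: charK0 => ->; rewrite -lt0n.
have Fm (i : 'I_k) : u ^+ (k.-1 - i) * v ^+ i \is monic by rewrite rpredM ?rpredX.
have szF (i : 'I_k) : size (u ^+ (k.-1 - i) * v ^+ i) = (deg u * k.-1).+1.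
  rewrite size_deg ?monic_neq0 // degM ?expf_neq0 ?monic_neq0 // !deg_exp -duv.
  by rewrite -mulnDr subnK // -ltnS prednK.
have cS : S`_(deg u * k.-1) = k%:R.
  rewrite coef_sum (eq_bigr (fun _ => 1)) ?sumr_const ?card_ord // => i _.
  by have := monicP (Fm i); rewrite /lead_coef szF.
have szS : size S = (deg u * k.-1).+1.
  apply/eqP; rewrite eqn_leq; apply/andP; split.
    rewrite (leq_trans (size_sum _ _ _)) //; apply/bigmax_leqP => i _.
    by rewrite szF.
  by rewrite ltnNge; apply: contraNN k0R => /leq_sizeP/(_ _ (leqnn _)) <-; rewrite cS.
by split=> //; rewrite /lead_coef szS.
Qed.

(** If [u <> v], then [u^k - v^k] has at least the degree of the cofactor of
    [u - v], which exceeds the bound for approximate roots. *)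
Lemma approximate_root_unique (K : fieldType) (charK0 : [pchar K] =i pred0)
    (k : nat) (f u v : {poly K}) :
    (0 < k)%N -> f != 0 -> deg u = deg v ->
  approximate_root k f u -> approximate_root k f v -> u = v.
Proof.
move=> k0 f0 duv [um ua] [vm va].
have [szS _] := sum_powers_lead charK0 k0 um vm duv.
have lf : lead_coef f != 0 by rewrite lead_coef_eq0.
have : (size (u ^+ k - v ^+ k)%R <= deg u * k.-1)%N.
  rewrite -(size_scale _ lf) scalerBr.
  have -> : lead_coef f *: u ^+ k - lead_coef f *: v ^+ k
    = (f - lead_coef f *: v ^+ k) - (f - lead_coef f *: u ^+ k) by ring.
  by rewrite (leq_trans (size_polyD _ _)) // size_polyN geq_max ua duv va.
rewrite subrXX; have [/eqP|uv] := eqVneq (u - v) 0.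
  by rewrite subr_eq0 => /eqP.
have S0 : \sum_(i < k) u ^+ (k.-1 - i) * v ^+ i != 0 by rewrite -size_poly_gt0 szS.
have := size_deg (mulf_neq0 uv S0); rewrite degM // => ->.
by rewrite [deg (\sum_(i < k) _)]/deg szS /= ltnNge leq_addl.
Qed.

(** Correct [u] by a monomial [c x^j] to remove the leading term of
    [f - a u^k], as long as its degree is too large. *)
Lemma approximate_root_exists (K : fieldType) (charK0 : [pchar K] =i pred0)
    (k m : nat) (f : {poly K}) :
    (0 < k)%N -> f != 0 -> deg f = (k * m)%N ->
  exists2 u, deg u = m & approximate_root k f u.
Proof.
move=> k0 f0 df; pose a := lead_coef f; pose E (u : {poly K}) := f - a *: u ^+ k.
have a0 : a != 0 by rewrite lead_coef_eq0.
have k0R : k%:R != 0 :> K by move/pcharf0P: charK0 => ->; rewrite -lt0n.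
have ltE u : u \is monic -> deg u = m -> (size (E u) <= k * m)%N.
  move=> um du; rewrite -df -ltnS -size_deg //; apply: size_sub_lead => //.
    have u0 : u != 0 by exact: monic_neq0.
    rewrite size_scale // !size_deg ?expf_neq0 // deg_exp df du.
    by rewrite mulnC.
  by rewrite lead_coefZ lead_coef_exp (monicP um) expr1n mulr1.
have step n u : (size (E u) < n)%N -> u \is monic -> deg u = m ->
  exists2 u, deg u = m & approximate_root k f u.
  elim: n u => // n IH u /ltnSE szE um du.
  have [le|lt] := leqP (size (E u)) (deg u * k.-1); first by exists u.
  have E0 : E u != 0 by rewrite -size_poly_gt0 (leq_ltn_trans _ lt).
  pose j := (deg (E u) - m * k.-1)%N.
  have dE : deg (E u) = (j + m * k.-1)%N.
    by rewrite subnK // -ltnS -size_deg // -du.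
  have jm : (j < m)%N.
    have := ltE _ um du; rewrite size_deg // dE -addSn.
    have -> : (k * m = m + m * k.-1)%N by rewrite -{1}(prednK k0) mulSn (mulnC m).
    by rewrite leq_add2r.
  pose c := lead_coef (E u) / (a * k%:R).
  have c0 : c != 0 by rewrite mulf_neq0 ?invr_eq0 ?mulf_neq0 // lead_coef_eq0.
  pose v := u + c *: 'X^j.
  have szlt : (size (c *: 'X^j) < size u)%N.
    by rewrite size_scale // size_polyXn size_deg ?monic_neq0 // du ltnS.
  have vm : v \is monic by rewrite monicE lead_coefDl // (monicP um).
  have dv : deg v = m by rewrite /deg size_polyDl.
  have [szS lS] := sum_powers_lead charK0 k0 vm um (etrans dv (esym du)).
  apply: (IH v) => //; apply: leq_trans szE.
  set S := \sum_(i < k) _ in szS lS.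
  have -> : E v = E u - (a * c) *: ('X^j * S).
    have := subrXX v u k; rewrite -/S {2}/v (addrC u) addrK => e.
    by rewrite /E -scalerA scalerAl -e !scalerBr; ring.
  have S0 : S != 0 by rewrite -size_poly_gt0 szS.
  have Xj0 : 'X^j != 0 :> {poly K} by rewrite monic_neq0 ?monicXn.
  apply: size_sub_lead => //.
    have ac0 : a * c != 0 by exact: mulf_neq0.
    rewrite size_scale // (size_deg E0) (size_deg (mulf_neq0 Xj0 S0)) degM // dE.
    by rewrite [deg 'X^j]/deg [deg S]/deg size_polyXn szS dv.
  rewrite lead_coefZ lead_coefM lead_coefXn lS mul1r.
  by rewrite mulrAC mulrC divfK // mulf_neq0.
apply: (step _ 'X^m (ltnSn _)); first exact: monicXn.
by rewrite /deg size_polyXn.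
Qed.

(** Approximate roots can be taken before substituting [h]; the scalar makes the
    result monic. *)
Lemma approximate_root_comp (K : fieldType) (k : nat) (g h u : {poly K}) :
    (0 < deg h)%N -> deg g = (k * deg u)%N -> approximate_root k g u ->
  approximate_root k (g \Po h) ((lead_coef h ^- deg u *: u) \Po h).
Proof.
move=> h1 dg [um ua]; have h1' := h1; rewrite deg_gt0 in h1'.
have h0 : lead_coef h != 0 by rewrite lead_coef_eq0 deg_gt0_neq0.
have lc0 : lead_coef h ^- deg u != 0 by rewrite invr_eq0 expf_neq0.
split.
  rewrite monicE lead_coef_comp // lead_coefZ (monicP um) mulr1.
  by rewrite size_scale // -/(deg u) mulVf // expf_neq0.
have -> : g \Po h
    - lead_coef (g \Po h) *: ((lead_coef h ^- deg u *: u) \Po h) ^+ k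
  = (g - lead_coef g *: u ^+ k) \Po h.
  rewrite comp_polyB comp_polyZ lead_coef_comp // -/(deg g) dg.
  rewrite comp_polyZ exprZn scalerA -mulrA exprVn -exprM mulnC divff ?expf_neq0 //.
  by rewrite mulr1 rmorphXn.
set R := g - _ in ua *.
have [->|R0] := eqVneq R 0; first by rewrite comp_poly0 size_poly0.
have Rh0 : R \Po h != 0 by rewrite comp_poly_eq0.
rewrite size_deg // !deg_comp deg_scale // mulnAC ltn_pmul2r //.
by rewrite -size_deg.
Qed.

(** The common multiple is the approximate [k]-th root of [g1 o h1], where [k] is
    the quotient of its degree by the lcm. *)
Lemma lcm_common_left_multiple (K : fieldType) (charK0 : [pchar K] =i pred0)
    (g1 g2 h1 h2 : {poly K}) :
    g1 \Po h1 = g2 \Po h2 -> (0 < deg g1)%N -> (0 < deg h1)%N ->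
    (0 < deg h2)%N ->
  exists v1 v2, [/\ v1 \Po h1 = v2 \Po h2,
    (deg v1 * deg h1 = lcmn (deg h1) (deg h2))%N &
    (deg v2 * deg h2 = lcmn (deg h1) (deg h2))%N].
Proof.
move=> eg g1p h1p h2p; set l := lcmn _ _.
have dd : (deg g1 * deg h1 = deg g2 * deg h2)%N by rewrite -!deg_comp eg.
have g2p : (0 < deg g2)%N.
  have : (0 < deg g1 * deg h1)%N by rewrite muln_gt0 g1p.
  by rewrite dd muln_gt0 => /andP[].
have ln : (l %| deg g1 * deg h1)%N by rewrite dvdn_lcm dvdn_mull //= dd dvdn_mull.
pose k := (deg g1 * deg h1 %/ l)%N.
have kl : (k * l = deg g1 * deg h1)%N by rewrite divnK.
have kp : (0 < k)%N.
  have : (0 < k * l)%N by rewrite kl muln_gt0 g1p.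
  by rewrite muln_gt0 => /andP[].
have f0 : g1 \Po h1 != 0 by apply: deg_gt0_neq0; rewrite deg_comp muln_gt0 g1p.
have l1 : (l %/ deg h1 * deg h1 = l)%N by rewrite divnK // dvdn_lcml.
have l2 : (l %/ deg h2 * deg h2 = l)%N by rewrite divnK // dvdn_lcmr.
have dg1 : deg g1 = (k * (l %/ deg h1))%N.
  by apply/eqP; rewrite -(eqn_pmul2r h1p) -mulnA l1 kl.
have dg2 : deg g2 = (k * (l %/ deg h2))%N.
  by apply/eqP; rewrite -(eqn_pmul2r h2p) -mulnA l2 kl dd.
have [u1 du1 a1] := approximate_root_exists charK0 kp (deg_gt0_neq0 g1p) dg1.
have [u2 du2 a2] := approximate_root_exists charK0 kp (deg_gt0_neq0 g2p) dg2.
rewrite -du1 in dg1; rewrite -du2 in dg2.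
have b1 := approximate_root_comp h1p dg1 a1.
have b2 := approximate_root_comp h2p dg2 a2.
have nz (h : {poly K}) n : (0 < deg h)%N -> lead_coef h ^- n != 0.
  by move=> hp; rewrite invr_eq0 expf_neq0 // lead_coef_eq0 deg_gt0_neq0.
exists (lead_coef h1 ^- deg u1 *: u1), (lead_coef h2 ^- deg u2 *: u2).
rewrite !deg_scale ?nz // du1 du2 l1 l2; split=> //; rewrite -du1 -du2.
rewrite -eg in b2; apply: (approximate_root_unique charK0 kp f0 _ b1 b2).
by rewrite !deg_comp !deg_scale ?nz // du1 du2 l1 l2.
Qed.

(** Elements of [K[h1]] and [K[h2]] in common have degrees divisible by the lcm,
    so they descend to constants along the powers of [v1 o h1]. *)
Lemma lcm_left_multiple_factors (K : fieldType) (charK0 : [pchar K] =i pred0)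
    (g1 g2 h1 h2 : {poly K}) :
    g1 \Po h1 = g2 \Po h2 -> (0 < deg g1)%N -> (0 < deg h1)%N ->
    (0 < deg h2)%N ->
  exists w v1 v2, [/\ v1 \Po h1 = v2 \Po h2,
    (deg v1 * deg h1 = lcmn (deg h1) (deg h2))%N,
    (deg v2 * deg h2 = lcmn (deg h1) (deg h2))%N,
    g1 = w \Po v1 & g2 = w \Po v2].
Proof.
move=> eg g1p h1p h2p.
have [v1 [v2 [ev dv1 dv2]]] := lcm_common_left_multiple charK0 eg g1p h1p h2p.
have m0 : v1 \Po h1 != 0.
  by apply: deg_gt0_neq0; rewrite deg_comp dv1 lcmn_gt0 h1p.
have [w ew] : exists w, g1 \Po h1 = w \Po (v1 \Po h1).
  have [n] := ubnP (size (g1 \Po h1)); elim: n {g1p} g1 g2 eg => // n IH.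
  move=> g1 g2 eg /ltnSE gn.
  have [d0|dp] := posnP (deg (g1 \Po h1)).
    exists (g1 \Po h1); move: d0; rewrite /deg.
    case: (size _) (size1_polyC (p := g1 \Po h1)) => [|[|]] // -> // _;
      by rewrite comp_polyC.
  have f0 := deg_gt0_neq0 dp.
  have /dvdnP[t dt] : (lcmn (deg h1) (deg h2) %| deg (g1 \Po h1))%N.
    by rewrite dvdn_lcm {2}eg !deg_comp !dvdn_mull.
  have [|c c0 lt] := @deg_descent _ (g1 \Po h1) ((v1 \Po h1) ^+ t) f0 (expf_neq0 _ m0).
    by rewrite dt deg_exp deg_comp dv1 mulnC.
  have e1 : (g1 - c *: v1 ^+ t) \Po h1 = (g1 \Po h1) - c *: (v1 \Po h1) ^+ t.
    by rewrite comp_polyB comp_polyZ rmorphXn.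
  have [||w ew] := IH (g1 - c *: v1 ^+ t) (g2 - c *: v2 ^+ t).
  - by rewrite e1 comp_polyB comp_polyZ rmorphXn /= -ev eg.
  - by rewrite e1 (leq_trans lt).
  exists (w + c *: 'X^t).
  by rewrite comp_polyD comp_polyZ comp_Xn_poly -ew e1 subrK.
exists w, v1, v2; split=> //.
- by apply: (comp_poly_cancelr h1p); rewrite -comp_polyA.
- by apply: (comp_poly_cancelr h2p); rewrite -comp_polyA -ev -eg.
Qed.

(** * Degrees of complete decompositions *)

(** The degrees of the irreducible factors of [f], the innermost first, where a
    linear factor may be left over on the outside.  Admitting it makes the notion
    insensitive to the linear polynomials that can be inserted between two
    factors, and gives a decomposition to polynomials of degree [1]. *)
Fixpoint composition_degrees (K : fieldType) (ds : seq nat) (f : {poly K}) : Prop :=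
  if ds is d :: ds' then
    exists g p, [/\ irreducible_KX p, deg p = d, f = g \Po p &
      composition_degrees ds' g]
  else deg f = 1%N.

Lemma linear_right_inverse (K : fieldType) (u : {poly K}) :
  deg u = 1%N -> exists2 v, deg v = 1%N & u \Po v = 'X.
Proof.
move=> u1; have u0 : u != 0 by apply: deg_gt0_neq0; rewrite u1.
have szu : size u = 2%N by rewrite size_deg // u1.
have eu : u = u`_1 *: 'X + (u`_0)%:P.
  apply/polyP=> -[|[|i]]; rewrite coefD coefZ coefX coefC /=.
  - by rewrite mulr0 add0r.
  - by rewrite mulr1 addr0.
  - by rewrite mulr0 addr0 nth_default // szu.
have a0 : u`_1 != 0 by rewrite -[u`_1]/(u`_2.-1) -szu -lead_coefE lead_coef_eq0.
exists ((u`_1)^-1 *: ('X - (u`_0)%:P)).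
  by rewrite deg_scale ?invr_eq0 // /deg size_XsubC.
set v := _ *: _; rewrite eu comp_polyD comp_polyZ comp_polyX comp_polyC.
by rewrite scalerA divff // scale1r subrK.
Qed.

Lemma irreducible_comp_linear (K : fieldType) (p u : {poly K}) :
  irreducible_KX p -> deg u = 1%N -> irreducible_KX (p \Po u).
Proof.
move=> [p1 pirr] u1; split; first by rewrite deg_comp u1 muln1.
move=> [b [c [b1 c1 e]]]; apply: pirr; have [v v1 uv] := linear_right_inverse u1.
exists b, (c \Po v); split=> //; first by rewrite deg_comp v1 muln1.
by rewrite comp_polyA -e -comp_polyA uv comp_polyXr.
Qed.

Lemma composition_degrees_linear (K : fieldType) ds (f u : {poly K}) :
    composition_degrees ds f -> deg u = 1%N ->
  composition_degrees ds (f \Po u).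
Proof.
case: ds => [|d ds] /= => [f1 u1|[g [p [pirr dp -> Hg]]] u1].
  by rewrite deg_comp f1 u1.
exists g, (p \Po u); split=> //; last by rewrite comp_polyA.
  exact: irreducible_comp_linear.
by rewrite deg_comp u1 muln1.
Qed.

Lemma composition_degrees_cat (K : fieldType) ds es (g f : {poly K}) :
    composition_degrees ds g -> composition_degrees es f ->
  composition_degrees (es ++ ds) (g \Po f).
Proof.
move=> Hg; elim: es f => [|e es IH] f /=; first exact: composition_degrees_linear.
move=> [h [p [pirr dp -> Hh]]]; exists (g \Po h), p.
by split=> //; [rewrite comp_polyA | apply: IH].
Qed.

Lemma composition_degrees_irreducible (K : fieldType) (p : {poly K}) :
  irreducible_KX p -> composition_degrees [:: deg p] p.
Proof.
by move=> pirr; exists 'X, p; split=> //=; rewrite ?comp_polyX // /deg size_polyX.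
Qed.

(** Irreducibility is not decidable over an arbitrary field, whence the double
    negation; it is harmless, because equality of degrees up to order is a
    boolean statement. *)
Lemma composition_degrees_exist (K : fieldType) (f : {poly K}) :
  (0 < deg f)%N -> classically (exists ds, composition_degrees ds f).
Proof.
have [n] := ubnP (deg f); elim: n f => // n IH f /ltnSE fn f0.
have [f1|f1] := eqVneq (deg f) 1%N; first by apply: classicW; exists [::].
have {f0 f1} f1 : (1 < deg f)%N by case: (deg f) f0 f1 => [|[|]].
move=> b Hb; apply: (@classic_EM (exists b c : {poly K},
  [/\ (1 < deg b)%N, (1 < deg c)%N & f = b \Po c])) => -[[g [h [g1 h1 e]]]|firr].
  have df : deg f = (deg g * deg h)%N by rewrite e deg_comp.
  have gn : (deg g < n)%N by apply: leq_trans fn; rewrite df ltn_Pmulr // ltnW.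
  have hn : (deg h < n)%N by apply: leq_trans fn; rewrite df ltn_Pmull // ltnW.
  apply: (IH g gn (ltnW g1)) => -[ds Hds]; apply: (IH h hn (ltnW h1)) => -[es Hes].
  by apply: Hb; exists (es ++ ds); rewrite e; apply: composition_degrees_cat.
by apply: Hb; exists [:: deg f]; apply: composition_degrees_irreducible.
Qed.

Lemma composition_degrees_gt0 (K : fieldType) ds (f : {poly K}) :
  composition_degrees ds f -> (0 < deg f)%N.
Proof.
elim: ds f => [|d ds IH] f /=; first by move=> ->.
by move=> [g [p [[p1 _] _ -> /IH g0]]]; rewrite deg_comp muln_gt0 g0 ltnW.
Qed.

(** If [v1 = s o t], then [t o p] and [q] have a common right component of degree
    [gcd(deg t * deg p, deg s * deg t) = deg t], which splits [q]. *)
Lemma complement_irreducible (K : fieldType) (p q v1 v2 : {poly K}) :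
    irreducible_KX q -> (0 < deg p)%N -> coprime (deg p) (deg q) ->
    v1 \Po p = v2 \Po q -> deg v1 = deg q ->
  irreducible_KX v1.
Proof.
move=> [q1 qirr] p0 cop ev dv1; split; first by rewrite dv1.
move=> [s [t [s1 t1 es]]]; apply: qirr.
have dq : deg q = (deg s * deg t)%N by rewrite -dv1 es deg_comp.
have cops : coprime (deg p) (deg s) by move: cop; rewrite dq coprimeMr => /andP[].
have lcm : (deg s * deg (t \Po p) = lcmn (deg (t \Po p)) (deg q))%N.
  rewrite deg_comp dq (mulnC (deg s) (deg t)) -muln_lcmr mulnCA.
  by congr (_ * _)%N; rewrite mulnC -muln_lcm_gcd (eqP cops) muln1.
have tp0 : (0 < deg (t \Po p))%N by rewrite deg_comp muln_gt0 p0 ltnW.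
have e : s \Po (t \Po p) = v2 \Po q by rewrite comp_polyA -es.
have [h [u1 [u2 [dh _ eq]]]] := gcd_right_component e (ltnW s1) tp0 lcm.
have dh' : deg h = deg t.
  by rewrite dh deg_comp dq (mulnC (deg s)) -muln_gcdr (eqP cops) muln1.
exists u2, h; rewrite dh'; split=> //.
suff -> : deg u2 = deg s by [].
have := dq; rewrite eq deg_comp dh' => /eqP.
by rewrite eqn_pmul2r ?(ltnW t1) // => /eqP.
Qed.

(** Jordan-Hoelder: compare each of the two decompositions [g1 o p = g2 o q] with
    one that passes through the least common multiple [v1 o p = v2 o q]. *)
Theorem ritt_first (K : fieldType) (charK0 : [pchar K] =i pred0)
    (f : {poly K}) (ds es : seq nat) :
  composition_degrees ds f -> composition_degrees es f -> perm_eq ds es.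
Proof.
have [n] := ubnP (deg f); elim: n f ds es => // n IH f ds es /ltnSE fn.
case: ds es => [|d ds] [|e es] //=.
- by move=> f1 [g [p [[p1 _] _ ef /composition_degrees_gt0 g0]]];
    move: f1; rewrite ef deg_comp; nia.
- by move=> [g [p [[p1 _] _ ef /composition_degrees_gt0 g0]]] f1;
    move: f1; rewrite ef deg_comp; nia.
move=> [g1 [p [pirr dp ef H1]]] [g2 [q [qirr dq eg H2]]].
have [p1 _] := pirr; have [q1 _] := qirr.
have g10 := composition_degrees_gt0 H1; have g20 := composition_degrees_gt0 H2.
have g1n : (deg g1 < n)%N.
  by apply: leq_trans fn; rewrite ef deg_comp ltn_Pmulr.
have g2n : (deg g2 < n)%N.
  by apply: leq_trans fn; rewrite eg deg_comp ltn_Pmulr.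
have eqf : g1 \Po p = g2 \Po q by rewrite -ef.
have [w [v1 [v2 [ev dv1 dv2 ew1 ew2]]]] :=
  lcm_left_multiple_factors charK0 eqf g10 (ltnW p1) (ltnW q1).
have v10 : (0 < deg v1)%N.
  by move: g10; rewrite ew1 deg_comp muln_gt0 => /andP[].
have v20 : (0 < deg v2)%N.
  by move: g20; rewrite ew2 deg_comp muln_gt0 => /andP[].
have w0 : (0 < deg w)%N.
  by move: g10; rewrite ew1 deg_comp muln_gt0 => /andP[].
have [h [u1 [u2 [dh eu1 eu2]]]] := gcd_right_component ev v10 (ltnW p1) dv1.
apply: (composition_degrees_exist w0) => -[ws Hw].
(* Coprime degrees: [v1] and [v2] are irreducible of degrees [deg q], [deg p]. *)
have [h1|h1] := leqP (deg h) 1.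
  have cop : coprime (deg p) (deg q).
    by rewrite /coprime -dh eqn_leq h1 dh gcdn_gt0 ltnW.
  have lcmE : lcmn (deg p) (deg q) = (deg p * deg q)%N.
    by rewrite -muln_lcm_gcd (eqP cop) muln1.
  have dv1q : deg v1 = deg q.
    by apply/eqP; rewrite -(eqn_pmul2r (ltnW p1)) dv1 lcmE mulnC.
  have dv2p : deg v2 = deg p.
    by apply/eqP; rewrite -(eqn_pmul2r (ltnW q1)) dv2 lcmE.
  have v1irr := complement_irreducible qirr (ltnW p1) cop ev dv1q.
  have v2irr : irreducible_KX v2.
    by apply: complement_irreducible pirr (ltnW q1) _ (esym ev) dv2p; rewrite coprime_sym.
  have Hg1 : composition_degrees (e :: ws) g1.
    by exists w, v1; split=> //; rewrite dv1q.
  have Hg2 : composition_degrees (d :: ws) g2.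
    by exists w, v2; split=> //; rewrite dv2p.
  have P1 := IH _ _ _ g1n H1 Hg1; have P2 := IH _ _ _ g2n H2 Hg2.
  have P1' : perm_eq (d :: ds) (d :: e :: ws) by rewrite perm_cons.
  have P2' : perm_eq (e :: es) (e :: d :: ws) by rewrite perm_cons.
  apply: (perm_trans P1'); rewrite perm_sym; apply: (perm_trans P2').
  by have /permPl := perm_catCA [:: e] [:: d] ws.
(* Here [p] and [q] are both linear over [h], so that [v1] and [v2] are linear. *)
have lin u v : irreducible_KX v -> v = u \Po h -> deg u = 1%N /\ deg v = deg h.
  move=> [v1' virr] ev'; have dv : deg v = (deg u * deg h)%N by rewrite ev' deg_comp.
  have du : deg u = 1%N.
    case: (ltngtP (deg u) 1) => // u1'; last by case: virr; exists u, h.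
    by move: v1'; rewrite dv; move: u1'; case: (deg u).
  by rewrite dv du mul1n.
have [_ dph] := lin _ _ pirr eu1; have [_ dqh] := lin _ _ qirr eu2.
have lcmh : lcmn (deg h) (deg h) = deg h by exact/lcmn_idPr.
have dv1' : deg v1 = 1%N.
  by apply/eqP; rewrite -(eqn_pmul2r (ltnW p1)) dv1 dqh dph lcmh mul1n.
have dv2' : deg v2 = 1%N.
  by apply/eqP; rewrite -(eqn_pmul2r (ltnW q1)) dv2 dqh dph lcmh mul1n.
rewrite -dp -dq dph dqh perm_cons.
have Hg1 : composition_degrees ws g1 by rewrite ew1; apply: composition_degrees_linear.
have Hg2 : composition_degrees ws g2 by rewrite ew2; apply: composition_degrees_linear.
apply: (perm_trans (IH _ _ _ g1n H1 Hg1)); rewrite perm_sym.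
exact: IH _ _ _ g2n H2 Hg2.
Qed.

(** * Decompositions in [A] *)

Lemma in_A_minus_K_deg (K : fieldType) (p : {poly K}) :
  in_A_minus_K p -> (1 < deg p)%N.
Proof.
move=> [[c [b ep]] pK]; have [b0|b0] := eqVneq b 0.
  by case: pK; exists c; rewrite ep b0 mul0r addr0.
have szb : size (b * 'X^2) = (deg b).+3.
  have X2 : 'X^2 != 0 :> {poly K} by rewrite monic_neq0 ?monicXn.
  by rewrite (size_deg (mulf_neq0 b0 X2)) degM // [deg 'X^2]/deg size_polyXn addn2.
rewrite /deg ep addrC size_polyDl szb //.
by rewrite (leq_ltn_trans (size_polyC_leq1 _)).
Qed.

Lemma composition_degrees_compose (K : fieldType) (s : seq {poly K}) :
    (forall p, p \in s -> irreducible_KX p) ->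
  composition_degrees (rev (map (@deg K) s)) (compose s).
Proof.
elim: s => [|p s IH] sirr /=; first by rewrite /deg size_polyX.
rewrite rev_cons -cats1; apply: composition_degrees_cat.
  by apply: composition_degrees_irreducible; apply: sirr; rewrite mem_head.
by apply: IH => q qs; apply: sirr; rewrite inE qs orbT.
Qed.

(** Replacing each factor by a complete decomposition never shortens a
    decomposition, and if its length does not change, nor do its degrees. *)
Lemma composition_degrees_refinement (K : fieldType) (s : seq {poly K}) :
    (forall p, p \in s -> (1 < deg p)%N) ->
  classically (exists ds, [/\ composition_degrees ds (compose s),
    (size s <= size ds)%N &
    size ds = size s -> perm_eq ds (map (@deg K) s)]).
Proof.
elim: s => [|p s IH] s1 /=.
  by apply: classicW; exists [::]; split; rewrite //= /deg size_polyX.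
have p1 : (1 < deg p)%N by apply: s1; rewrite mem_head.
move=> b Hb; apply: IH => [q qs|[ds [Hds szds pds]]].
  by apply: s1; rewrite inE qs orbT.
apply: (composition_degrees_exist (ltnW p1)) => -[es Hes].
apply: Hb; exists (ds ++ es); split; first exact: composition_degrees_cat.
  rewrite size_cat; case: es Hes => [/= e|e es _]; first by rewrite e in p1.
  by rewrite /= addnS ltnS (leq_trans szds) ?leq_addr.
case: es Hes => [/= e|e [|e' es] Hes]; first by rewrite e in p1.
  rewrite size_cat addn1 => -[/pds pd]; rewrite cats1.
  have -> : e = deg p.
    by case: Hes => g [q [_ <- -> g1]]; rewrite deg_comp g1 mul1n.
  by rewrite perm_rcons perm_cons.
by rewrite size_cat /= => e1; exfalso; move: szds e1; clear; lia.
Qed.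

(** The factors of [s] are irreducible in [A] only; the equality of lengths is
    what keeps them from splitting in [K[x]]. *)
Lemma maximal_decomposition_degrees (K : fieldType)
    (charK0 : [pchar K] =i pred0) (a : {poly K}) (s t : seq {poly K}) :
    decomposition_A a s -> decomposition_KX a t -> size s = size t ->
  perm_eq (map (@deg K) s) (map (@deg K) t).
Proof.
move=> [sA es] [tirr et] st.
have Ht := composition_degrees_compose tirr; rewrite -et in Ht.
apply: (@composition_degrees_refinement K s) => [p /sA[pA _]|[ds [Hds _ pds]]].
  exact: in_A_minus_K_deg.
rewrite -es in Hds; have P := ritt_first charK0 Hds Ht.
have Q : perm_eq ds (map (@deg K) s).
  by apply: pds; rewrite (perm_size P) size_rev size_map.
rewrite perm_sym in Q; apply: (perm_trans Q); apply: (perm_trans P).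
by rewrite perm_rev.
Qed.

Theorem theorem1p4 (K : fieldType) (charK0 : [pchar K] =i pred0)
    (a : {poly K}) (a_in_A : in_A a) (a_notin_K : ~ in_K a)
    (a_regular : regular a)
    (r : nat) (p q : r.-tuple {poly K})
    (max_p : maximal_decomposition_A a p)
    (max_q : maximal_decomposition_A a q) :
  exists sigma : 'S_r,
    forall i : 'I_r, deg (tnth p i) = deg (tnth q (sigma i)).
Proof.
have [_ [n [[s As sn] nmax] [t KXt tn]]] := a_regular.
have [Ap [_ pmax]] := max_p; have [Aq _] := max_q.
have nr : n = r.
  apply/eqP; rewrite eqn_leq -{1}sn -{1}(size_tuple p) (pmax _ As).
  by rewrite -(size_tuple p) nmax.
have Pp : perm_eq (map (@deg K) p) (map (@deg K) t).
  by apply: maximal_decomposition_degrees Ap KXt _; rewrite // size_tuple tn.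
have Pq : perm_eq (map (@deg K) q) (map (@deg K) t).
  by apply: maximal_decomposition_degrees Aq KXt _; rewrite // size_tuple tn.
rewrite perm_sym in Pq.
have /tuple_permP[sigma e] : perm_eq (map_tuple (@deg K) p) (map_tuple (@deg K) q).
  exact: perm_trans Pp Pq.
exists sigma => i; have /(congr1 (fun u => tnth u i)) := val_inj e.
by rewrite tnth_mktuple !tnth_map.
Qed.
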